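(* Let $r>0$ and $s$ be real numbers. Let $e_0,e_1,e_2,\dots$ be independent and identically distributed real random variables with cumulative distribution function $F$ having probability density function $f$ with respect to Lebesgue measure. Let $X_0$ be a real random variable such that $(X_0,e_0)$ is independent of $(e_1,e_2,\dots)$, and define the ARMA(1,1) process $X_i - rX_{i-1} = e_i + s e_{i-1}$ for $i\ge 1$. Fix $x\in\mathbb{R}$, put $M_0=-\infty$ and $M_n=\max_{1\le i\le n}X_i$ for $n\ge1$, and for $\mathbf{y}=(y_0,y_1)\in\mathbb{R}^2$ and $n\ge 0$ define $$G_n(\mathbf{y}) = P(M_n\le x,\ X_n\le y_0,\ e_n\le y_1),$$ so that $G_0(\mathbf{y})=P(X_0\le y_0,\ e_0\le y_1)$. Define the linear integral operator $\mathcal{K}$ (depending on $x$) acting on functions $h$ of $\mathbf{z}=(z_0,z_1)\in\mathbb{R}^2$ by $$\mathcal{K}h(\mathbf{y}) = r\int\int_{a_{\mathbf{y}\mathbf{z}}}^{\infty} dz_0\, f(y_{0x}-rz_0-sz_1)\, h(z_0,dz_1),$$ where $y_{0x}=\min(y_0,x)$, $a_{\mathbf{y}\mathbf{z}}=(y_{0x}-sz_1-y_1)/r$, and $h(z_0,dz_1)$ denotes Lebesgue--Stieltjes integration with respect to the second argument $z_1$ of $h$. Then for every $n\ge 1$ and every $\mathbf{y}\in\mathbb{R}^2$, $$G_n(\mathbf{y}) = \mathcal{K}G_{n-1}(\mathbf{y}).$$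
   Context: All notation is introduced in the claim. The dependence of $G_n$ and $\mathcal{K}$ on the fixed level $x$ is suppressed. *)

(* Defs.v *)
From HB Require Import structures.
From mathcomp Require Import all_boot all_order all_algebra.
From mathcomp Require Import all_classical all_reals all_analysis.
Set Implicit Arguments. Unset Strict Implicit. Unset Printing Implicit Defensive.
Import Order.TTheory GRing.Theory Num.Theory.
Import numFieldNormedType.Exports.
Local Open Scope classical_set_scope.
Local Open Scope ring_scope.

Section Defs.
Context {R : realType}.

Definition cumulative_of (F : R -> R) (nd : {homo F : x y / (x <= y)%O})
  (rc : forall x, F%function @ at_right x --> F%function x) : cumulative R R :=
  HB.pack F (isCumulative.Build R _ R F nd rc).

(* Lebesgue--Stieltjes integral  \int_{z in D} g(z) dF(z)  for a nondecreasing
   right-continuous F (the Stieltjes measure of F); conventionally 0 when F is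
   not such a function (this case never arises in the theorem). *)
Definition stieltjes_integral (F : R -> R) (D : set R) (g : R -> \bar R) : \bar R :=
  match pselect ({homo F : x y / (x <= y)%O} /\
                 (forall x, F%function @ at_right x --> F%function x)) with
  | left H => (\int[lebesgue_stieltjes_measure (cumulative_of H.1 H.2)]_(z in D) g z)%E
  | right _ => 0%E
  end.

Definition Kop (r s x : R) (f : R -> R) (h : R -> R -> R) (y0 y1 : R) : \bar R :=
  let y0x : R := Num.min y0 x in
  let a (z1 : R) : R := ((y0x - s * z1 - y1) / r)%R in
  let g (z0 z1 : R) : \bar R := (f (y0x - r * z0 - s * z1)%R)%:E in
  (r%:E * \int[lebesgue_measure]_(z0 in [set: R])
     stieltjes_integral (h z0) [set z1 : R | (a z1 <= z0)%R] (g z0))%E.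

Section Process.
Context {d : measure_display} {T : measurableType d}.

Fixpoint arma (r s : R) (X0 : T -> R) (e : nat -> T -> R) (n : nat) : T -> R :=
  match n with
  | 0 => X0
  | n'.+1 => fun t => r * arma r s X0 e n' t + e n'.+1 t + s * e n' t
  end.

Definition running_max (X : nat -> T -> R) (n : nat) (t : T) : \bar R :=
  (\big[Order.max/-oo]_(1 <= i < n.+1) (X i t)%:E)%E.

Definition Gfun (P : probability T R) (r s : R) (X0 : T -> R) (e : nat -> T -> R)
  (x : R) (n : nat) (y0 y1 : R) : R :=
  fine (P [set t | (running_max (arma r s X0 e) n t <= x%:E)%E /\
                   arma r s X0 e n t <= y0 /\ e n t <= y1]).

Definition mutually_independent (P : probability T R) (e : nat -> T -> R) : Prop :=
  forall (J : seq nat) (B : nat -> set R), uniq J ->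
    (forall j, j \in J -> measurable (B j)) ->
    P (\bigcap_(j in [set j | j \in J]) (e j @^-1` B j)) =
    (\prod_(j <- J) P (e j @^-1` B j))%E.

Definition indep_vec_seq (P : probability T R) (X0 : T -> R) (e : nat -> T -> R) : Prop :=
  forall (A : set (R * R)) (J : seq nat) (B : nat -> set R),
    measurable A -> uniq J -> (forall j, j \in J -> (0 < j)%N) ->
    (forall j, j \in J -> measurable (B j)) ->
    P ((fun t => (X0 t, e 0%N t)) @^-1` A
        `&` \bigcap_(j in [set j | j \in J]) (e j @^-1` B j)) =
    (P ((fun t => (X0 t, e 0%N t)) @^-1` A) *
     P (\bigcap_(j in [set j | j \in J]) (e j @^-1` B j)))%E.

End Process.
End Defs.

(* Main.v *)
(* Given the past up to time n - 1, the event X_n <= min(y0, x), e_n <= y1 says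
   that e_n is at most min(y0x - r X_{n-1} - s e_{n-1}, y1), and e_n is
   independent of that past; so G_n(y) is the mean over {M_{n-1} <= x} of F at
   this bound.  The substitution v = y0x - r z0 - s e_{n-1} writes that value of
   F as r times the integral of f(y0x - r z0 - s e_{n-1}) over
   z0 >= max(X_{n-1}, a(e_{n-1})).  Exchanging the two integrals by Tonelli, the
   inner one at fixed z0 is an integral against the law of e_{n-1} restricted to
   {M_{n-1} <= x, X_{n-1} <= z0}, whose distribution function is
   G_{n-1}(z0, .). *)
Require Import Defs.
From HB Require Import structures.
From mathcomp Require Import all_boot all_order all_algebra.
From mathcomp Require Import all_classical all_reals all_analysis.
From mathcomp Require Import ring lra measurable_realfun.
Import Order.TTheory GRing.Theory Num.Theory.
Import numFieldNormedType.Exports.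
Local Open Scope classical_set_scope.
Local Open Scope ring_scope.

(** * Integration against the restriction of a measure *)

Section integral_restriction.
Context d (T : measurableType d) (R : realType).
Local Open Scope ereal_scope.

(** The restricted measure gives no mass to [A] minus [D], and on subsets of [D] it coincides with
    [mu]. *)
Lemma ge0_integral_mrestr (mu : {measure set T -> \bar R}) (D A : set T)
    (mD : measurable D) (f : T -> \bar R) :
  measurable A -> measurable_fun A f -> (forall x, A x -> 0 <= f x) ->
  \int[mrestr mu mD]_(x in A) f x = \int[mu]_(x in A `&` D) f x.
Proof.
move=> mA mf f0.
have mAD := measurableI _ _ mA mD.
have mADC := measurableD mA mD.
rewrite (ge0_negligible_integral (N := A `\` D) (D := A))//.
  rewrite setDD.
  apply: eq_measure_integral => B mB; rewrite subsetI => -[_ BD] /=.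
  by rewrite /mrestr setIidl.
by rewrite /= /mrestr setIC setDIK measure0.
Qed.

End integral_restriction.

(** * Stieltjes integrals against distribution functions *)

Section stieltjes.
Context (R : realType).

(** Monotonicity and right-continuity of [G] follow from those of [m], so the default value 0 of
    [stieltjes_integral] is excluded. The Stieltjes measure of [G] is then [m] itself, by uniqueness
    on half-open intervals. *)
Lemma stieltjes_integral_cdf (m : {measure set (measurableTypeR R) -> \bar R})
    (G : R -> R) (D : set R) (g : R -> \bar R) :
  (forall t, (G t)%:E = m `]-oo, t]%classic) ->
  stieltjes_integral G D g = (\int[m]_(z in D) g z)%E.
Proof.
move=> mG.
have ndG : {homo G : x y / (x <= y)%O}.
  move=> a b ab; rewrite -lee_fin !mG le_measure ?inE//.
  exact: subset_itvl.
have rcG a : G%function @ at_right a --> G%function a.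
  (* The right limit exists by monotonicity and the lower bound 0. Its value can then be read along
     the sequence [a + n.+1%:R^-1], where continuity of [m] from above yields [G a]. *)
  have cvg_inf : G t @[t --> a^'+] --> inf (G @` `]a, (a + 1)%R]%classic).
    apply: nondecreasing_at_right_cvgr; first by rewrite ltBSide/= ltrDl.
      by move=> *; exact: ndG.
    exists 0%R => _ [t _ <-]; rewrite -lee_fin mG; exact: measure_ge0.
  have cvg_seq : G (a + n.+1%:R^-1) @[n --> \oo] -->
      inf (G @` `]a, (a + 1)%R]%classic).
    move/cvg_at_rightP : cvg_inf; apply; split=> [n|]; rewrite ?ltrDl //.
    rewrite -[X in _ --> X]addr0; apply: (@cvgD _ R^o); first exact: cvg_cst.
    by rewrite gtr0_cvgV0 ?cvg_shiftS; [exact: cvgr_idn | near=> n].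
  suff : G (a + n.+1%:R^-1) @[n --> \oo] --> G a.
    by move=> /(cvg_unique _ cvg_seq) <-.
  have -> : (fun n => G (a + n.+1%:R^-1)) =
      fine \o (fun n => m `]-oo, a + n.+1%:R^-1]%classic).
    by apply/funext => n /=; rewrite -mG.
  apply: fine_cvg; rewrite mG (itvNycEbigcap false).
  apply: (nonincreasing_cvg_mu (mu := m)) => [| | |i j ij].
  - by rewrite -mG ltry.
  - by move=> ?; exact: measurable_itv.
  - by apply: bigcap_measurable => // ? _; exact: measurable_itv.
  - apply/subsetPset; apply: subset_itvl.
    by rewrite bnd_simp lerD2l lef_pV2 ?posrE// ler_nat.
rewrite /stieltjes_integral; case: pselect => [H|[]//].
have : cumulative_of H.1 H.2 =1 G by [].
move: (cumulative_of _ _) => F FG.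
apply: eq_measure_integral => A mA _.
apply: lebesgue_stieltjes_measure_unique => // _ [[a b]] _ <- /=.
rewrite /lebesgue_stieltjes_measure /measure_extension/=.
rewrite measurable_mu_extE/=; last exact: is_ocitv.
have [ab | ba] := leP a b; last first.
  by rewrite set_itv_ge ?wlength0 ?measure0// bnd_simp -leNgt ltW.
rewrite wlength_itv_bnd//= EFinB !FG !mG.
have -> : `]a, b]%classic = `]-oo, b] `\` `]-oo, a].
  by rewrite -[RHS]setCK setCD setCitvl setUC -[LHS]setCK setCitv.
rewrite measureD ?setIidr//; first exact: subset_itvl.
by have := ltry (G b); rewrite mG.
Unshelve. all: end_near.
Qed.
End stieltjes.

(** * The change of variable [u = k - r * z] for Lebesgue measure *)

Section reflection.
Context (R : realType) (r k : R).
Hypothesis r0 : (0 < r)%R.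
Let phi (z : measurableTypeR R) : measurableTypeR R := (k - r * z)%R.

Let measurable_phi : measurable_fun setT phi.
Proof.
apply: (@measurable_funB _ _ _ setT (cst k) (fun z => r * z)) => //.
exact: mulrl_measurable.
Qed.

(** Taking preimages under [phi] divides lengths by [r], which the scaling by [r] undoes; uniqueness
    of Lebesgue measure reduces the claim to half-open intervals. *)
Lemma pushforward_reflection (A : set R) : measurable A ->
  pushforward (mscale (NngNum (ltW r0)) lebesgue_measure) phi A =
  lebesgue_measure A.
Proof.
move=> mA; apply/esym/lebesgue_measure_unique => // _ [[a b]] _ <- /=.
rewrite /pushforward /mscale/=.
have -> : phi @^-1` `]a, b]%classic =
    `[((k - b) / r)%R, ((k - a) / r)%R[%classic.
  apply/seteqP; split => z /=;
      rewrite !in_itv/= /phi ler_pdivrMr// ltr_pdivlMr//.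
    by move=> /andP[h1 h2]; apply/andP; split; lra.
  by move=> /andP[h1 h2]; apply/andP; split; lra.
rewrite !lebesgue_measure_itv/= !lte_fin ltr_pM2r ?invr_gt0// ltrD2l ltrN2.
case: ifPn => ab; last by rewrite mule0.
rewrite -!EFinB -EFinM; congr EFin; field; exact: lt0r_neq0.
Qed.

(** This is the origin of the factor [r] in front of the integral in [Kop]. *)
Lemma ge0_integral_reflection (f : R -> \bar R) (b : R) :
  measurable_fun setT f -> (forall u, 0 <= f u)%E ->
  (\int[lebesgue_measure]_(u in `]-oo, (k - r * b)%R]) f u =
   r%:E * \int[lebesgue_measure]_(z in `[b, +oo[) f (k - r * z)%R)%E.
Proof.
move=> mf f0.
transitivity (\int[pushforward (mscale (NngNum (ltW r0)) lebesgue_measure) phi]_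
    (u in `]-oo, (k - r * b)%R]) f u)%E.
  by apply: eq_measure_integral => A mA _; exact/esym/pushforward_reflection.
rewrite ge0_integral_pushforward//; last exact: measurable_funTS.
rewrite ge0_integral_mscale//; last 3 first.
- by rewrite -[X in measurable X]setTI; exact: measurable_phi.
- by apply: measurable_funTS; exact: measurableT_comp mf measurable_phi.
- by move=> z _; exact: f0.
congr (_ * integral _ _ _)%E.
by apply/seteqP; split => z /=;
  rewrite !in_itv/= andbT /phi lerD2l lerN2 ler_pM2l.
Qed.
End reflection.

(** * Independence from a generated sigma-algebra, and freezing of a variable *)

Section independence.
Context d (T : measurableType d) (R : realType) (P : probability T R).
Local Open Scope ereal_scope.

(** As functions of [A], both sides are finite measures that agree on the pi-system [G], hence on
    the sigma-algebra it generates. Since [G] contains [setT], a constant sequence serves as the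
    exhaustion. *)
Lemma indep_g_sigma_algebra (G : set (set T)) (C : set T) :
  G `<=` measurable -> setI_closed G -> G setT -> measurable C ->
  (forall A, G A -> P (A `&` C) = P A * P C) ->
  forall A, <<s G >> A -> P (A `&` C) = P A * P C.
Proof.
move=> Gm GI GT mC indep A sGA.
have PC : P C = (fine (P C))%:E by rewrite fineK// fin_num_measure.
have PC0 : (0 <= fine (P C))%R by rewrite fine_ge0.
rewrite [in RHS]PC muleC.
apply: (g_sigma_algebra_measure_unique G Gm (fun=> setT) _ _
  (mrestr P mC) (mscale (NngNum PC0) P)) => //.
- by rewrite bigcup_const//; exists 0%N.
- by move=> B GB /=; rewrite /mrestr /mscale/= -PC muleC indep.
- by move=> _ /=; rewrite /mrestr setTI ltey_eq fin_num_measure.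
Qed.

(** Factorization on rectangles makes the joint law of [(Y, V)] the product of the marginal laws,
    and a product measure integrates the measures of sections. *)
Lemma indep_xsection d1 d2 (T1 : measurableType d1) (T2 : measurableType d2)
    (Y : T -> T1) (V : T -> T2) (S : set (T1 * T2)) :
  measurable_fun setT Y -> measurable_fun setT V ->
  (forall A B, measurable A -> measurable B ->
    P (Y @^-1` A `&` V @^-1` B) = P (Y @^-1` A) * P (V @^-1` B)) ->
  measurable S ->
  P [set t | S (Y t, V t)] = \int[P]_t P (V @^-1` xsection S (Y t)).
Proof.
move=> mY mV indep mS.
have mYV : measurable_fun setT (fun t => (Y t, V t)).
  exact: measurable_fun_pair.
pose Y' : {RV P >-> T1} := HB.pack Y (isMeasurableFun.Build _ _ _ _ _ mY).
pose V' : {RV P >-> T2} := HB.pack V (isMeasurableFun.Build _ _ _ _ _ mV).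
pose YV' : {RV P >-> (T1 * T2)%type} :=
  HB.pack (fun t => (Y t, V t)) (isMeasurableFun.Build _ _ _ _ _ mYV).
transitivity ((distribution P Y' \x distribution P V') S).
  by rewrite (product_measure_unique (m' := distribution P YV')).
rewrite /product_measure1 ge0_integral_distribution//.
exact: measurable_fun_xsection.
Qed.

End independence.

(** * The running maximum and the sigma-algebra of the past *)

Lemma running_maxS d (T : measurableType d) (R : realType) (X : nat -> T -> R)
    (x : R) n t :
  (running_max X n.+1 t <= x%:E)%E =
  (running_max X n t <= x%:E)%E && (X n.+1 t <= x).
Proof. by rewrite {1}/running_max big_nat_recr//= ge_max lee_fin. Qed.

Section past.
Context d (T : measurableType d) (R : realType) (P : probability T R).
Variables (X0 : {RV P >-> R}) (e : nat -> {RV P >-> R}).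

(** [X0] and [e 0] may be dependent, so they are tested jointly by one set [A] of the plane; the
    later noises up to [e n] are tested one by one. *)
Definition past_event (n : nat) (A : set (R * R)) (B : nat -> set R) : set T :=
  (fun t => (X0 t, e 0 t)) @^-1` A `&`
  \bigcap_(j in [set j | j \in iota 1 n]) (e j @^-1` B j).

Definition past (n : nat) : set (set T) :=
  [set E | exists A B, [/\ measurable A, (forall j, measurable (B j)) &
                           E = past_event n A B]].

Lemma past_setI n : setI_closed (past n).
Proof.
move=> _ _ [A [B [mA mB ->]]] [A' [B' [mA' mB' ->]]].
exists (A `&` A'), (fun j => B j `&` B' j); split; first exact: measurableI.
  by move=> j; exact: measurableI.
by rewrite /past_event setIACA -bigcapI preimage_setI.
Qed.

Lemma past_setT n : past n setT.
Proof.
exists setT, (fun=> setT); split => //.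
by apply/seteqP; split.
Qed.

Lemma past_measurable n : past n `<=` measurable.
Proof.
move=> _ [A [B [mA mB ->]]]; apply: measurableI.
  rewrite -[X in measurable X]setTI.
  exact: (measurable_fun_pair (measurable_funP X0) (measurable_funP (e 0))).
apply: bigcap_measurableType => j _; exact: measurable_funPTI.
Qed.

(** Intersecting with the event on [e n.+1] gives a past event of level [n.+1]. [indep_vec_seq]
    splits off the pair [(X0, e 0)] at both levels, and mutual independence turns the rest into
    products that differ by the factor of index [n.+1]. *)
Lemma past_indep n (C : set R) :
  mutually_independent P (fun i => e i : T -> R) ->
  indep_vec_seq P X0 (fun i => e i : T -> R) ->
  measurable C -> forall E, past n E ->
  P (E `&` e n.+1 @^-1` C) = (P E * P (e n.+1 @^-1` C))%E.
Proof.
move=> indE indX mC _ [A [B [mA mB ->]]].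
pose B' j := if j == n.+1 then C else B j.
have mB' j : measurable (B' j) by rewrite /B'; case: ifP.
have B'E j : j \in iota 1 n -> B' j = B j.
  by rewrite mem_iota /B' => /andP[_]; case: eqP => // ->; rewrite ltnn.
have iota0 m j : j \in iota 1 m -> (0 < j)%N by rewrite mem_iota => /andP[].
have iotaS : iota 1 n.+1 = rcons (iota 1 n) n.+1.
  by rewrite -(addn1 n) iotaD cats1 add1n addn1.
have -> : past_event n A B `&` e n.+1 @^-1` C = past_event n.+1 A B'.
  rewrite /past_event -setIA; congr (_ `&` _).
  rewrite iotaS.
  apply/seteqP; split => t /=.
    move=> [h hC] j /=; rewrite mem_rcons inE => /orP[/eqP ->|jn].
      by rewrite /B' eqxx.
    by rewrite B'E//; exact: h.
  move=> h; split=> [j jn|].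
    by rewrite -B'E//; apply: h; rewrite /= mem_rcons inE jn orbT.
  have := h n.+1; rewrite /B' eqxx; apply => /=.
  by rewrite mem_rcons inE eqxx.
rewrite /past_event indX ?iota_uniq// => [|j]; last exact: iota0.
rewrite [in RHS]indX ?iota_uniq// => [|j]; last exact: iota0.
rewrite !indE ?iota_uniq// iotaS -cats1 big_cat/= big_seq1.
rewrite {2}/B' eqxx muleA; congr (_ * _ * _)%E.
by apply: eq_big_seq => j jn; rewrite B'E.
Qed.

Let S n := g_sigma_algebraType (past n).

Lemma past_X0 n : measurable_fun setT (X0 : S n -> R).
Proof.
move=> _ B mB; rewrite setTI; apply: sub_sigma_algebra.
exists (B `*` setT), (fun=> setT); split => //; first exact: measurableX.
by apply/seteqP; split => t //= [[]].
Qed.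

Lemma past_e n i : (i <= n)%N -> measurable_fun setT (e i : S n -> R).
Proof.
move=> ile _ B mB; rewrite setTI; apply: sub_sigma_algebra.
(* [e 0] is visible only through the set [A] of pairs, a later [e i] only through the family [B]. *)
case: i ile => [_|i ile].
  exists (setT `*` B), (fun=> setT); split => //; first exact: measurableX.
  by apply/seteqP; split => t //= [[]].
exists setT, (fun j => if j == i.+1 then B else setT); split => //.
  by move=> j; case: ifP.
apply/seteqP; split => t /=.
  by move=> Bt; split => // j _ /=; case: eqP => // ->.
by move=> [_ /(_ i.+1)]/=; rewrite eqxx; apply; rewrite mem_iota.
Qed.

Lemma past_arma r s n i : (i <= n)%N ->
  measurable_fun setT (arma r s X0 (fun i => e i : T -> R) i : S n -> R).
Proof.
elim: i => [_|i IH ile]; first exact: past_X0.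
have ile' := ltnW ile.
apply: measurable_funD; first apply: measurable_funD.
- exact: measurable_funM (measurable_cst r) (IH ile').
- exact: past_e.
- exact: measurable_funM (measurable_cst s) (past_e _ _ ile').
Qed.

Lemma past_running_max r s (x : R) n i : (i <= n)%N ->
  (measurable : set (set (S n)))
    [set t |
      (running_max (arma r s X0 (fun i => e i : T -> R)) i t <= x%:E)%E].
Proof.
set X := arma r s X0 (fun i => e i : T -> R).
elim: i => [_|i IH ile].
  (* The empty maximum is [-oo], so the event is the whole space. *)
  rewrite (_ : mkset _ = setT)//; apply/seteqP; split => // t _ /=.
  by rewrite /running_max big_nil leNye.
rewrite (_ : mkset _ = [set t | (running_max X i t <= x%:E)%E] `&`
    [set t | X i.+1 t <= x]).
  apply: measurableI; first exact: (IH (ltnW ile)).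
  rewrite -[X in measurable X]setTI; apply: measurable_fun_le => //.
  exact: past_arma.
by apply/seteqP; split => t /=; rewrite running_maxS => /andP.
Qed.

End past.

(** * The recurrence from [m] to [m.+1] *)

Section recurrence.
Context d (T : measurableType d) (R : realType) (P : probability T R).
Variables (r s x : R) (f : R -> R) (X0 : {RV P >-> R}).
Variable e : nat -> {RV P >-> R}.
Hypotheses (r0 : 0 < r) (mf : measurable_fun [set: R] f).
Hypothesis f0 : forall u, 0 <= f u.
Variable m : nat.
Variables (y0 y1 : R).

Let X := arma r s X0 (fun i => e i : T -> R).
Let c := Num.min y0 x.
Let a (z : R) := (c - s * z - y1) / r.
Let E := [set t | (running_max X m t <= x%:E)%E].
Let W : set (measurableTypeR R * T) :=
  [set p | E p.2 /\ X m p.2 <= p.1 /\ a (e m p.2) <= p.1].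
(** The integrand for Tonelli: integrated over [T] it gives the inner integral of [Kop], and
    integrated over the real line and multiplied by [r] it gives the probability of the noise
    section. *)
Let H : measurableTypeR R * T -> \bar R :=
  (fun p => (f (c - r * p.1 - s * e m p.2))%:E) \_ W.

(** The past sigma-algebra is coarser than that of [T], so measurability facts proved for the past
    transfer to [T]. *)
Let sub_past (A : set T) :
  (past d T R P X0 e m).-sigma.-measurable A -> measurable A.
Proof.
apply: smallest_sub; first exact: sigma_algebra_measurable.
exact: past_measurable.
Qed.

Let mX : measurable_fun setT (X m).
Proof.
move=> _ B mB; rewrite setTI; apply: sub_past.
rewrite -[X in measurable X]setTI; exact: past_arma.
Qed.

Let mE : measurable E.
Proof. by apply: sub_past; exact: past_running_max. Qed.

Let mW : measurable W.
Proof.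
have -> : W = (snd @^-1` E) `&`
    ([set p | X m p.2 <= p.1] `&` [set p | a (e m p.2) <= p.1]) by [].
apply: measurableI.
  by rewrite -[X in measurable X]setTI; exact: measurable_snd.
have mfst : measurable_fun setT (fst : measurableTypeR R * T -> R).
  exact: measurable_fst.
have msnd : measurable_fun setT (snd : measurableTypeR R * T -> T).
  exact: measurable_snd.
apply: measurableI; rewrite -[X in measurable X]setTI;
  apply: measurable_fun_le => //.
  exact: measurableT_comp mX msnd.
have me : measurable_fun setT (fun p : measurableTypeR R * T => e m p.2).
  exact: measurableT_comp msnd.
apply: measurable_funM => //; apply: measurable_funB => //.
apply: measurable_funB => //; exact: measurable_funM.
Qed.

Let mH : measurable_fun setT H.
Proof.
have mfst : measurable_fun setT (fst : measurableTypeR R * T -> R).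
  exact: measurable_fst.
have msnd : measurable_fun setT (snd : measurableTypeR R * T -> T).
  exact: measurable_snd.
have mh : measurable_fun setT
    (fun p : measurableTypeR R * T => f (c - r * p.1 - s * e m p.2)).
  apply: (measurableT_comp mf); apply: measurable_funB => //; last first.
    by apply: measurable_funM => //; exact: measurableT_comp msnd.
  by apply: measurable_funB => //; exact: measurable_funM.
apply/(measurable_restrictT _ mW)/measurable_funTS.
exact/measurable_EFinP.
Qed.

Let H0 p : (0 <= H p)%E.
Proof. by rewrite /H patchE; case: ifP => // _; rewrite lee_fin. Qed.

(** [Gfun] at level [m] and first argument [z] is the distribution function of the image under [e m]
    of [P] restricted to [E] and [X m <= z]. Pulled back to [T], the domain [a z1 <= z] becomes the
    last clause of [W]. *)
Lemma stieltjes_integral_Gfun (z : R) :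
  stieltjes_integral (Gfun P r s X0 (fun i => e i : T -> R) x m z)
    [set z1 : R | (a z1 <= z)%R] (fun z1 => (f (c - r * z - s * z1))%:E) =
  (\int[P]_t H (z, t))%E.
Proof.
have mEz : measurable (E `&` [set t | X m t <= z]).
  apply: measurableI => //; rewrite -[X in measurable X]setTI.
  exact: measurable_fun_le.
have mg : measurable_fun setT (fun z1 => (f (c - r * z - s * z1))%:E).
  apply/measurable_EFinP; apply: measurableT_comp => //.
  by apply: measurable_funB => //; exact: measurable_funM.
have mD : measurable [set z1 : R | a z1 <= z].
  rewrite -[X in measurable X]setTI; apply: measurable_fun_le => //.
  apply: measurable_funM => //; apply: measurable_funB => //.
  by apply: measurable_funB => //; exact: measurable_funM.
have meD : measurable (e m @^-1` [set z1 : R | a z1 <= z]).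
  exact: measurable_funPTI.
pose em : T -> measurableTypeR R := e m.
have mem : measurable_fun setT em by exact: measurable_funP (e m).
transitivity (\int[pushforward (mrestr P mEz) em]_
    (z1 in [set z1 : R | (a z1 <= z)%R]) (f (c - r * z - s * z1))%:E)%E.
  apply: stieltjes_integral_cdf => // t.
  rewrite /Gfun fineK.
    congr (P _); apply/seteqP.
    by split => u /=; rewrite /pushforward/= in_itv/=; tauto.
  rewrite fin_num_measure//.
  rewrite (_ : mkset _ =
    E `&` ([set t | X m t <= z] `&` [set u | e m u <= t]))//.
  apply: measurableI => //.
  apply: measurableI; rewrite -[X in measurable X]setTI;
    exact: measurable_fun_le.
rewrite ge0_integral_pushforward//; last 2 first.
- exact: measurable_funTS.
- by move=> u _; rewrite lee_fin.
rewrite ge0_integral_mrestr//; last 2 first.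
- by apply: measurable_funTS; exact: measurableT_comp mg mem.
- by move=> u _; rewrite lee_fin.
rewrite integral_mkcond; apply: eq_integral => t _.
rewrite /H !patchE; congr (if _ then _ else _).
apply/idP/idP; rewrite !inE /W /=; tauto.
Qed.

Lemma noise_section_integral (F : R -> R) (n : nat) t :
  (forall t, (F t)%:E = (\int[lebesgue_measure]_(u in `]-oo, t]) (f u)%:E)%E) ->
  (forall (i : nat) (t : R), P (e i @^-1` `]-oo, t]) = (F t)%:E) ->
  P (e n @^-1` [set v | E t /\ v <= c - r * X m t - s * e m t /\ v <= y1]) =
  (r%:E * \int[lebesgue_measure]_z H (z, t))%E.
Proof.
move=> Ff eF.
have [Et|nEt] := pselect (E t); last first.
  rewrite (_ : mkset _ = set0); last by rewrite -subset0 => v [].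
  rewrite preimage_set0 measure0 integral0_eq ?mule0// => z _.
  by rewrite /H patchE memNset// => -[].
pose k := c - s * e m t.
(* As [r] is positive, [k - r * b] is the minimum of [k - r * X m t] and [k - r * a (e m t)], and
   the latter equals [y1]: the two upper bounds on the noise become one half-line. *)
pose b := Num.max (X m t) (a (e m t)).
rewrite (_ : mkset _ = `]-oo, k - r * b]%classic); last first.
  have bv v :
      (v <= k - r * b) = (v <= c - r * X m t - s * e m t) && (v <= y1).
    rewrite lerBrDr addrC -lerBrDr -ler_pdivlMl// ge_max; congr (_ && _).
      by rewrite ler_pdivlMl// /k; apply/idP/idP => ?; lra.
    rewrite /a ler_pdivrMr// mulrAC mulVf ?lt0r_neq0// mul1r /k.
    by apply/idP/idP => ?; lra.
  apply/seteqP; split => v /=; rewrite in_itv/= bv.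
    by move=> [_ [-> ->]].
  by move=> /andP[].
rewrite eF Ff (ge0_integral_reflection R r k r0 (EFin \o f))//; last first.
  exact/measurable_EFinP.
congr (_ * _)%E.
rewrite integral_mkcond; apply: eq_integral => z _.
rewrite /H !patchE /=.
have -> : ((z, t) \in W) = (z \in `[b, +oo[%classic).
  apply/idP/idP; rewrite !inE /W /= in_itv/= andbT ge_max.
    by move=> [_ [-> ->]].
  by move=> /andP[].
case: ifPn => // _; congr (f _)%:E; rewrite /k; ring.
Qed.

(** The right-hand side is rewritten by Tonelli as a mean of noise-section probabilities; the
    left-hand side reaches the same mean by freezing the past. *)
Lemma Gfun_Kop (F : R -> R) :
  (forall t, (F t)%:E = (\int[lebesgue_measure]_(u in `]-oo, t]) (f u)%:E)%E) ->
  (forall (i : nat) (t : R), P (e i @^-1` `]-oo, t]) = (F t)%:E) ->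
  mutually_independent P (fun i => e i : T -> R) ->
  indep_vec_seq P X0 (fun i => e i : T -> R) ->
  (Gfun P r s X0 (fun i => e i : T -> R) x m.+1 y0 y1)%:E =
  Kop r s x f (Gfun P r s X0 (fun i => e i : T -> R) x m) y0 y1.
Proof.
move=> Ff eF indE indX; rewrite /Kop/=.
under eq_integral do rewrite stieltjes_integral_Gfun.
rewrite (fubini_tonelli H)//.
rewrite -ge0_integralZl//; last 3 first.
- exact: (measurable_fun_fubini_tonelli_G H mH H0).
- by move=> t _; apply: integral_ge0.
- by rewrite lee_fin ltW.
under [RHS]eq_integral do rewrite -(noise_section_integral F m.+1)//.
pose S := g_sigma_algebraType (past d T R P X0 e m).
pose Q : set (S * R) :=
  [set p | E p.1 /\ p.2 <= c - r * X m p.1 - s * e m p.1 /\ p.2 <= y1].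
have mid : measurable_fun setT (idfun : T -> S).
  by move=> _ B mB; rewrite setTI; exact: sub_past.
(* Measurability is needed for the past sigma-algebra in the first coordinate, which is why [X m],
   [e m] and [E] were shown measurable with respect to the past. *)
have mQ : measurable Q.
  have mfst : measurable_fun setT (fst : S * R -> S) by exact: measurable_fst.
  have msnd : measurable_fun setT (snd : S * R -> R) by exact: measurable_snd.
  have -> : Q = (fst @^-1` E) `&`
    ([set p | p.2 <= c - r * X m p.1 - s * e m p.1] `&` [set p | p.2 <= y1]).
    by [].
  apply: measurableI.
    rewrite -[X in measurable X]setTI.
    by apply: mfst => //; exact: past_running_max.
  apply: measurableI; rewrite -[X in measurable X]setTI;
    apply: measurable_fun_le => //.
  have mXS : measurable_fun setT (X m : S -> R) by exact: past_arma.
  have meS : measurable_fun setT (e m : S -> R) by exact: past_e.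
  apply: measurable_funB; first apply: measurable_funB => //.
    by apply: measurable_funM => //; exact: measurableT_comp mXS mfst.
  by apply: measurable_funM => //; exact: measurableT_comp meS mfst.
transitivity (P [set t | Q (t, e m.+1 t)]).
  rewrite /Gfun (_ : mkset _ = [set t | Q (t, e m.+1 t)]).
    rewrite fineK// fin_num_measure// -[X in measurable X]setTI.
    exact: (measurable_fun_pair mid (measurable_funP (e m.+1))).
  (* By the ARMA recursion the bound says that [X m.+1] is at most [c], the minimum of [y0] and [x];
     its [x] part is the condition that the running maximum gains at [m.+1]. *)
  have le_c t : (e m.+1 t <= c - r * X m t - s * e m t) =
      (X m.+1 t <= y0) && (X m.+1 t <= x).
    by rewrite -le_min -/c /X/=; apply/idP/idP => ?; lra.
  apply/seteqP; split => t; rewrite /Q /= running_maxS le_c /E /=.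
    by move=> [/andP[-> ->] [-> ->]].
  by move=> [-> [/andP[-> ->] ->]].
(* Taking the identity into the past sigma-algebra as the first variable lets
   indep_xsection freeze the whole past at once. *)
rewrite (indep_xsection _ _ _ P _ _ _ _ (idfun : T -> S) (e m.+1) Q mid)//.
  apply: eq_integral => t _; congr (P (_ @^-1` _)).
  by apply/seteqP; split => v; rewrite /xsection/= inE.
(* [A] ranges over the whole past sigma-algebra, while [past_indep] covers only its generating
   pi-system. *)
move=> A B mA mB; apply: indep_g_sigma_algebra mA => //.
- exact: past_measurable.
- exact: past_setI.
- exact: past_setT.
- exact: measurable_funPTI.
- exact: past_indep.
Qed.

End recurrence.

Theorem theorem2p1 (R : realType) (d : measure_display) (T : measurableType d)
  (P : probability T R) (r s x : R) (F f : R -> R)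
  (X0 : {RV P >-> R}) (e : nat -> {RV P >-> R}) :
  0 < r ->
  measurable_fun [set: R] f -> (forall u, 0 <= f u) ->
  (forall t, (F t)%:E = (\int[lebesgue_measure]_(u in `]-oo, t]) (f u)%:E)%E) ->
  (forall (i : nat) (t : R), P (e i @^-1` `]-oo, t]) = (F t)%:E) ->
  mutually_independent P (fun i => e i : T -> R) ->
  indep_vec_seq P X0 (fun i => e i : T -> R) ->
  forall (n : nat) (y0 y1 : R), (1 <= n)%N ->
    (Gfun P r s X0 (fun i => e i : T -> R) x n y0 y1)%:E =
    Kop r s x f (Gfun P r s X0 (fun i => e i : T -> R) x n.-1) y0 y1.
Proof.
move=> r0 mf f0 Ff eF indE indX [//|m] y0 y1 _.
exact: Gfun_Kop Ff eF indE indX.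
Qed.
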